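(* Let $n \geq 1$ be an integer. For each integer $k$ with $1 \leq k \leq n$, let $p_{n,k} \in [0,1]$ be the number defined by $$B(k-1, n, p_{n,k}) = \frac{1}{2},$$ where $B(\cdot, n, p)$ is the cumulative distribution function of the binomial distribution with parameters $n$ and $p$. Then the $n$ values $p_{n,1}, \ldots, p_{n,n}$ are irrational, with the only exception that, for odd $n$, $p_{n, \lceil n/2 \rceil} = \frac{1}{2}$. That is: if $n$ is even, $p_{n,k}$ is irrational for all $1 \leq k \leq n$; if $n$ is odd, $p_{n,\lceil n/2\rceil} = \frac{1}{2}$ and $p_{n,k}$ is irrational for all $1 \leq k \leq n$ with $k \neq \lceil n/2 \rceil$.
   Context: For integers $n \geq 1$ and $0 \leq k \leq n$ and a real number $0 \leq p \leq 1$, the binomial cumulative distribution function is $$B(k,n,p) = \sum_{i=0}^{k} \binom{n}{i} p^i (1-p)^{n-i}$$ (with the convention $0^0 = 1$). For fixed $n \ge 1$ and $1 \leq k \leq n$, the equation $B(k-1,n,p) = \frac12$ has exactly one solution $p \in [0,1]$; this solution is denoted $p_{n,k}$. *)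

(* Defs.v *)
From mathcomp Require Import all_boot all_order all_algebra.
From mathcomp Require Import ring lra.
From mathcomp Require Import boolp classical_sets reals.
Set Implicit Arguments.
Unset Strict Implicit.
Unset Printing Implicit Defensive.
Import Order.TTheory GRing.Theory Num.Theory.
Local Open Scope ring_scope.

(* Note that [0 ^+ 0 = 1] in MathComp, and that the subtraction [n - i] is
   exact for [k <= n]. *)
Definition binomial_cdf (R : realType) (k n : nat) (p : R) : R :=
  \sum_(i < k.+1) ('C(n, i))%:R * p ^+ i * (1 - p) ^+ (n - i).

Definition half_solution (R : realType) (n k : nat) : set R :=
  [set p : R | 0 <= p <= 1 /\ binomial_cdf k.-1 n p = 1 / 2]%classic.
Arguments half_solution : clear implicits.

(* The number p_{n,k}. For 1 <= k <= n, [half_solution R n k] is a singleton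
   (lemma [half_solution_exists_unique]), so the default value 0 plays no role
   and [half_prob R n k] is its unique element (lemma [half_probP]). *)
Definition half_prob (R : realType) (n k : nat) : R :=
  xget 0 (half_solution R n k).

Section WellDefined.
Variable R : realType.
Implicit Types (p q : R) (n k : nat).

Let pmf n p i : R := ('C(n, i))%:R * p ^+ i * (1 - p) ^+ (n - i).

Let cdfE k n p : binomial_cdf k n p = \sum_(i < k.+1) pmf n p i.
Proof. by []. Qed.

Let pmf_ge0 n p i : 0 <= p <= 1 -> 0 <= pmf n p i.
Proof.
move=> /andP[p0 p1]; rewrite /pmf !mulr_ge0 ?exprn_ge0 //; lra.
Qed.

Lemma binomial_cdf0 n p : binomial_cdf 0 n p = (1 - p) ^+ n.
Proof.
by rewrite /binomial_cdf big_ord_recl big_ord0 bin0 expr0 subn0 addr0 !mul1r.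
Qed.

Lemma binomial_cdf_full n p : binomial_cdf n n p = 1.
Proof.
have -> : 1 = ((1 - p) + p) ^+ n by rewrite subrK expr1n.
rewrite exprDn; apply: eq_bigr => i _.
by rewrite -mulr_natl; ring.
Qed.

Let pmfS n p i : (i.+1 <= n.+1)%N ->
  pmf n.+1 p i.+1 = (1 - p) * pmf n p i.+1 + p * pmf n p i.
Proof.
move=> le_in; rewrite /pmf binS natrD subSS exprS.
move: le_in; rewrite ltnS leq_eqVlt => /orP[/eqP ->|lt_in].
  by rewrite bin_small // subnn; ring.
have -> : (n - i = (n - i.+1).+1)%N by rewrite subnSK.
by rewrite exprS; ring.
Qed.

Lemma binomial_cdfS k n p : (k.+1 <= n.+1)%N ->
  binomial_cdf k.+1 n.+1 p =
  (1 - p) * binomial_cdf k.+1 n p + p * binomial_cdf k n p.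
Proof.
move=> le_kn; rewrite !cdfE [LHS]big_ord_recl [X in (1 - p) * X]big_ord_recl /=.
have -> : pmf n.+1 p 0 = (1 - p) * pmf n p 0.
  by rewrite /pmf !bin0 !subn0 exprS; ring.
rewrite mulrDr -addrA; congr (_ + _).
rewrite !mulr_sumr -big_split /=; apply: eq_bigr => i _.
by rewrite pmfS //; apply: leq_trans le_kn; rewrite ltn_ord.
Qed.

Lemma binomial_cdf_decr k n p q : (k < n)%N -> 0 <= p -> p < q -> q <= 1 ->
  binomial_cdf k n q < binomial_cdf k n p.
Proof.
move=> + p0 pq q1; elim: n k => [//|n IHn] [|k] lt_kn.
  by rewrite !binomial_cdf0 ltrXn2r //; lra.
rewrite !binomial_cdfS; try exact: ltnW.
have lt1 := IHn k lt_kn.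
have le2 : binomial_cdf k.+1 n q <= binomial_cdf k.+1 n p.
  move: lt_kn; rewrite ltnS leq_eqVlt => /orP[/eqP <-|/IHn /ltW //].
  by rewrite !binomial_cdf_full.
have le3 : binomial_cdf k n p <= binomial_cdf k.+1 n p.
  rewrite !cdfE [X in _ <= X]big_ord_recr /= lerDl pmf_ge0 //; lra.
by nra.
Qed.

Lemma half_solution_exists_unique n k : (1 <= k <= n)%N ->
  exists! p : R, half_solution R n k p.
Proof.
case: k => [//|k] /= lt_kn.
pose P : {poly R} := (1 / 2)%:P -
  \sum_(i < k.+1) ('C(n, i))%:R%:P * 'X^i * (1 - 'X) ^+ (n - i).
have PE p : P.[p] = 1 / 2 - binomial_cdf k n p.
  rewrite /P /binomial_cdf !hornerE horner_sum; congr (_ - _).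
  by apply: eq_bigr => i _; rewrite !hornerE.
have B0 : binomial_cdf k n (0 : R) = 1.
  rewrite cdfE big_ord_recl big1 /pmf /= ?bin0 ?expr0 ?subr0 ?expr1n; first lra.
  by move=> i _; rewrite exprS; ring.
have B1 : binomial_cdf k n (1 : R) = 0.
  rewrite cdfE big1 /pmf // => i _.
  have lt_in : (i < n)%N by apply: leq_trans lt_kn; exact: ltn_ord.
  by rewrite subrr expr0n subn_eq0 leqNgt lt_in mulr0.
have [||p p01 /rootP] := @poly_ivt R P 0 1; first exact: ler01.
  by rewrite !PE B0 B1; apply/andP; split; lra.
rewrite PE => /eqP; rewrite subr_eq0 => /eqP Bp.
have {}p01 : 0 <= p <= 1 by move: p01; rewrite ?in_itv.
exists p; split=> [//|q [/andP[q0 q1] Bq]]; case/andP: p01 => p0 p1.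
rewrite /= in Bq.
case: (ltgtP p q) => // lt_pq.
  by have := binomial_cdf_decr lt_kn p0 lt_pq q1; rewrite Bq -Bp ltxx.
by have := binomial_cdf_decr lt_kn q0 lt_pq p1; rewrite Bq -Bp ltxx.
Qed.

Lemma half_probP n k p : (1 <= k <= n)%N ->
  half_solution R n k p <-> p = half_prob R n k.
Proof.
move=> kn; have [q [Sq uq]] := half_solution_exists_unique kn.
have Sh : half_solution R n k (half_prob R n k) by apply: xgetPex; exists q.
by split=> [Sp|-> //]; rewrite -(uq _ Sp) -(uq _ Sh).
Qed.

End WellDefined.

(* Main.v *)
(** If [p = a / (a + c)] in lowest terms, then clearing denominators in
    [B(k-1, n, p) = 1/2] equates the first [k] terms of the binomial expansion
    of [(a + c) ^ n] with the remaining ones. Modulo [a] every term but [c ^ n]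
    vanishes, and modulo [c] every term but [a ^ n]; these two terms lie on
    opposite sides, so coprimality forces [a = c = 1], that is [p = 1/2]. At
    [p = 1/2] the symmetry of the binomial coefficients leaves [n + 1 = 2 k]. *)
Require Import Defs.
From mathcomp Require Import all_boot all_order all_algebra.
From mathcomp Require Import boolp classical_sets reals.
From mathcomp Require Import zify lra.
Import Order.TTheory GRing.Theory Num.Theory.
Local Open Scope ring_scope.

Definition binomial_term (n a c i : nat) : nat :=
  ('C(n, i) * (a ^ i * c ^ (n - i)))%N.

(** This is B(k-1, n, a/(a+c)) = 1/2 multiplied by [(a + c) ^ n], kept in [nat] so that divisibility
    arguments apply directly. *)
Definition balanced (n a c k : nat) : Prop :=
  (\sum_(0 <= i < k) binomial_term n a c i =
   \sum_(k <= i < n.+1) binomial_term n a c i)%N.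

Lemma sum_binomial_term n a c :
  (\sum_(0 <= i < n.+1) binomial_term n a c i = (a + c) ^ n)%N.
Proof.
rewrite addnC expnDn big_mkord; apply: eq_bigr => i _.
by rewrite /binomial_term [(a ^ _ * _)%N]mulnC.
Qed.

Lemma dvdn_binomial_term_l n a c i :
  (0 < i)%N -> (a %| binomial_term n a c i)%N.
Proof.
by move=> i_gt0; rewrite /binomial_term dvdn_mull // dvdn_mulr // dvdn_exp.
Qed.

Lemma dvdn_binomial_term_r n a c i :
  (i < n)%N -> (c %| binomial_term n a c i)%N.
Proof.
by move=> ltin; rewrite /binomial_term !dvdn_mull // dvdn_exp // subn_gt0.
Qed.

Lemma balanced_coprime n a c k : (1 <= k <= n)%N -> coprime a c ->
  balanced n a c k -> a = 1%N /\ c = 1%N.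
Proof.
move=> /andP[k_gt0 lekn] cop_ac; rewrite /balanced => bal.
have dvd1 d m : coprime d m -> (d %| m ^ n)%N -> d = 1%N.
  by move=> /(coprimeXr n) /eqP cop /gcdn_idPl; rewrite cop.
split.
- apply: (dvd1 _ _ cop_ac).
  (* Since k >= 1, the term [c ^ n] of index 0 lies in the left sum, and it is the only one that [a]
     need not divide. *)
  have : (a %| \sum_(0 <= i < k) binomial_term n a c i)%N.
    rewrite bal big_nat; apply: dvdn_sum => i /andP[leki _].
    exact/dvdn_binomial_term_l/(leq_trans k_gt0).
  rewrite big_ltn // dvdn_addl; last first.
    rewrite big_nat; apply: dvdn_sum => i /andP[i_gt0 _].
    exact: dvdn_binomial_term_l.
  by rewrite /binomial_term bin0 subn0 expn0 !mul1n.
- apply: (dvd1 _ a); first by rewrite coprime_sym.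
  (* Mirror argument: since k <= n, the exceptional term [a ^ n] of index n lies in the right
     sum. *)
  have : (c %| \sum_(k <= i < n.+1) binomial_term n a c i)%N.
    rewrite -bal big_nat; apply: dvdn_sum => i /andP[_ ltik].
    exact/dvdn_binomial_term_r/(leq_trans ltik).
  rewrite big_nat_recr //= dvdn_addr; last first.
    rewrite big_nat; apply: dvdn_sum => i /andP[_ ltin].
    exact: dvdn_binomial_term_r.
  by rewrite /binomial_term binn subnn expn0 muln1 mul1n.
Qed.

Lemma ltn_sum_bin n j k : (j < k <= n.+1)%N ->
  (\sum_(0 <= i < j) 'C(n, i) < \sum_(0 <= i < k) 'C(n, i))%N.
Proof.
move=> /andP[ltjk lekn].
rewrite (big_cat_nat (leq0n j) (ltnW ltjk)) /= -[X in (X < _)%N]addn0 ltn_add2l.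
by rewrite big_ltn // ltn_addr // bin_gt0 -ltnS (leq_trans ltjk).
Qed.

Lemma sum_bin_tail n k : (k <= n.+1)%N ->
  (\sum_(k <= i < n.+1) 'C(n, i) = \sum_(0 <= i < n.+1 - k) 'C(n, i))%N.
Proof.
move=> lekn; rewrite big_nat_rev /= -{1}(add0n k) big_addn !big_nat.
apply: eq_bigr => i /andP[_ lti].
rewrite (_ : k + n.+1 - (i + k).+1 = n - i)%N; last lia.
by rewrite bin_sub //; lia.
Qed.

(** By symmetry the tail is an initial sum of length n + 1 - k. Initial sums of a row of Pascal's
    triangle grow strictly with their length, so equality forces k = n + 1 - k. *)
Lemma balanced11 n k : (k <= n.+1)%N -> balanced n 1 1 k <-> n.+1 = k.*2.
Proof.
move=> lekn; have termE i : binomial_term n 1 1 i = 'C(n, i).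
  by rewrite /binomial_term !exp1n !muln1.
rewrite /balanced; under eq_bigr do rewrite termE.
under [X in _ = X]eq_bigr do rewrite termE.
rewrite sum_bin_tail //; split=> [eq_sum | n1E]; last first.
  by congr bigop; congr index_iota; lia.
case: (ltngtP k (n.+1 - k)%N) => [lt|lt|]; last lia.
- by have := ltn_sum_bin n k (n.+1 - k); rewrite lt leq_subr eq_sum ltnn => /(_ isT).
- by have := ltn_sum_bin n (n.+1 - k) k; rewrite lt lekn eq_sum ltnn => /(_ isT).
Qed.

Section RationalSolutions.
Variable R : realType.

Lemma binomial_cdf_frac n k a c : (k <= n)%N -> (0 < a + c)%N ->
  binomial_cdf k n (a%:R / (a + c)%:R : R) * ((a + c) ^ n)%:R =
  (\sum_(0 <= i < k.+1) binomial_term n a c i)%:R.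
Proof.
move=> lekn ac_gt0; set b := (a + c)%N.
have b_neq0 : b%:R != 0 :> R by rewrite pnatr_eq0 -lt0n.
have -> : binomial_cdf k n (a%:R / b%:R : R) =
    \sum_(i < k.+1) 'C(n, i)%:R * (a%:R / b%:R) ^+ i * (c%:R / b%:R) ^+ (n - i).
  apply: eq_bigr => i _; congr (_ * _ ^+ _).
  by rewrite -{1}(divff b_neq0) -mulrBl -natrB ?leq_addr // addKn.
rewrite big_mkord natr_sum mulr_suml; apply: eq_bigr => i _.
have lein : (i <= n)%N by rewrite (leq_trans _ lekn) // -ltnS.
(* Splitting b^n as b^i b^(n-i) lets each factor cancel one of the two denominators. *)
rewrite !natrM !natrX !expr_div_n -{4}(subnKC lein) exprD -!mulrA.
congr (_ * (_ * _)); rewrite mulrCA [_^-1 * (_ * _)]mulrCA.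
by rewrite mulKf ?expf_neq0 // mulVf ?expf_neq0 // mulr1.
Qed.

Lemma half_solution_frac n k a c : (1 <= k <= n)%N -> (0 < a + c)%N ->
  half_solution R n k (a%:R / (a + c)%:R) <-> balanced n a c k.
Proof.
move=> /andP[k_gt0 lekn] ac_gt0.
have b_gt0 : 0 < (a + c)%:R :> R by rewrite ltr0n.
have bX_neq0 : ((a + c) ^ n)%:R != 0 :> R.
  by rewrite pnatr_eq0 -lt0n expn_gt0 ac_gt0.
have lekn1 : (k.-1 <= n)%N by rewrite (leq_trans (leq_pred k)).
have cdfE := binomial_cdf_frac _ _ _ _ lekn1 ac_gt0; rewrite prednK // in cdfE.
have totE : ((a + c) ^ n)%:R = (\sum_(0 <= i < k) binomial_term n a c i)%:R
    + (\sum_(k <= i < n.+1) binomial_term n a c i)%:R :> R.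
  by rewrite -natrD -big_cat_nat // ?sum_binomial_term // ltnW.
rewrite /half_solution /balanced /=; split=> [[_ cdf2] | bal].
  apply/eqP; rewrite -(eqr_nat R); apply/eqP.
  by move: cdfE; rewrite cdf2 totE; lra.
split; last first.
  by apply: (mulIf bX_neq0); rewrite cdfE totE -bal; lra.
rewrite divr_ge0 ?ler0n //= ler_pdivrMr // mul1r ler_nat.
exact: leq_addr.
Qed.

Lemma half_solution_half n k : (1 <= k <= n)%N ->
  half_solution R n k (1 / 2) <-> n.+1 = k.*2.
Proof.
move=> kn; rewrite -balanced11; last by case/andP: kn => _ /leqW.
(* [1 / 2] is the fraction a/(a+c) with a = c = 1, up to conversion. *)
exact: (half_solution_frac n k 1 1 kn).
Qed.

Lemma rational_unit_frac (p : R) : 0 <= p <= 1 -> rational p ->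
  exists a c : nat, [/\ coprime a c, (0 < a + c)%N & p = a%:R / (a + c)%:R].
Proof.
move=> p01 [q _ qp]; move: p01; rewrite -qp ler0q => /andP[q_ge0 rq_le1].
have q_le1 : q <= 1 by rewrite -(ler_rat R) rmorph1.
have num_ge0 : 0 <= numq q by rewrite numq_ge0.
have numE : numq q = `|numq q|%N :> int by rewrite gez0_abs.
have denE : denq q = `|denq q|%N :> int by rewrite gez0_abs ?denq_ge0.
have le_num_den : (`|numq q| <= `|denq q|)%N.
  rewrite -lez_nat -numE -denE -(ler_int rat).
  have den_gt0 : 0 < (denq q)%:~R :> rat by rewrite ltr0z denq_gt0.
  by rewrite -[X in _ <= X]mul1r -ler_pdivrMr // divq_num_den.
(* The subtraction is exact because p <= 1, and gcd(a, a + c) = gcd(a, c) carries coprimality over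
   from the reduced fraction. *)
exists `|numq q|%N, (`|denq q| - `|numq q|)%N; rewrite subnKC //; split.
- have := coprime_num_den q; rewrite -{1}(subnKC le_num_den).
  by rewrite /coprime gcdnDl.
- by rewrite absz_gt0 denq_neq0.
- by rewrite -{1}(divq_num_den q) fmorph_div !rmorph_int {1}numE {1}denE.
Qed.

Lemma half_prob_irrational n k : (1 <= k <= n)%N -> n.+1 <> k.*2 ->
  irrational (half_prob R n k).
Proof.
move=> kn n1_neq rat_p.
(* Reflexivity, read through [half_probP], says that [half_prob R n k] solves its defining
   equation. *)
have /(half_probP (half_prob R n k) kn) sol : half_prob R n k = half_prob R n k by [].
have [a [c [cop ac_gt0 pE]]] := rational_unit_frac _ sol.1 rat_p.
move: sol; rewrite pE half_solution_frac // => bal.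
have [a1 c1] := balanced_coprime _ _ _ _ kn cop bal.
apply: n1_neq; rewrite -balanced11; first by rewrite a1 c1 in bal.
by case/andP: kn => _ /leqW.
Qed.

End RationalSolutions.

Theorem theorem4p1 (R : realType) (n : nat) (hn : (1 <= n)%N) :
  (~~ odd n ->
     forall k : nat, (1 <= k <= n)%N -> irrational (half_prob R n k)) /\
  (odd n ->
     half_prob R n (uphalf n) = 1 / 2 /\
     forall k : nat, (1 <= k <= n)%N -> k <> uphalf n ->
       irrational (half_prob R n k)).
Proof.
(* For even n, n + 1 is odd and never equals 2k; for odd n, only k = [uphalf n] gives n + 1 = 2k. *)
split=> [even_n k kn | odd_n]; first by apply: half_prob_irrational => //; lia.
have n1E : n.+1 = (uphalf n).*2 by lia.
have kn : (1 <= uphalf n <= n)%N by lia.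
split=> [|k kkn k_neq]; last by apply: half_prob_irrational => //; lia.
by apply/esym/(half_probP _ kn)/half_solution_half.
Qed.
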